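(* Let $B$ be a bipartite graph with a perfect matching $M$ and let $X\subseteq V(B)$ be such that the matching porosity of $\partial_B(X)$ equals $k$. Then there exists a guard $F\subseteq M$ for $\partial_B(X)$ with $|F|\le 2k+k^2$.
   Context: $\partial_B(X)$ is the set of edges of $B$ with exactly one endpoint in $X$; its matching porosity is $\max_{M'}|M'\cap\partial_B(X)|$ over all perfect matchings $M'$ of $B$. A subgraph $K$ of $B$ is $M$-conformal if $M$ contains a perfect matching of $B-V(K)$ and $M$ contains a perfect matching of $K$. An $M$-conformal cycle $C$ crosses $\partial_B(X)$ if $E(C)\cap\partial_B(X)\neq\emptyset$. A set $F\subseteq M$ is a guard for $\partial_B(X)$ if $\partial_B(X)\cap M\subseteq F$ and $F\cap E(C)\ne\emptyset$ for every $M$-conformal cycle $C$ crossing $\partial_B(X)$. *)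

(* Defs.v *)
From mathcomp Require Import all_boot.

Set Implicit Arguments.
Unset Strict Implicit.
Unset Printing Implicit Defensive.

(* Finite simple graphs; an edge is the 2-element set of its endpoints.       *)
Record sgraph (T : finType) := SGraph {
  vset : {set T};
  eset : {set {set T}};
  esetP : forall e : {set T}, e \in eset -> e \subset vset /\ #|e| = 2
}.

Section Definitions.
Variable T : finType.
Implicit Types (G K C : sgraph T) (X S : {set T}) (M N F : {set {set T}}).

Definition subgraph K G : Prop :=
  vset K \subset vset G /\ eset K \subset eset G.

Lemma del_esetP G S :
  {in [set e in eset G | [disjoint e & S]],
     forall e : {set T}, e \subset vset G :\: S /\ #|e| = 2}.
Proof.
move=> e; rewrite inE => /andP[/esetP[sub_e card_e] disj_e].
by split; rewrite // subsetD sub_e.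
Qed.

(* G - S *)
Definition del_vertices G S : sgraph T := SGraph (@del_esetP G S).

Definition bipartite G : Prop :=
  exists A1 A2 : {set T},
    [/\ A1 :|: A2 = vset G, [disjoint A1 & A2] &
        {in eset G, forall e : {set T}, #|e :&: A1| = 1 /\ #|e :&: A2| = 1}].

Definition perfect_matching G N : bool :=
  [&& N \subset eset G, trivIset N & cover N == vset G].

Definition edge_cut G X : {set {set T}} := [set e in eset G | #|e :&: X| == 1].

Definition matching_porosity G X : nat :=
  \max_(N : {set {set T}} | perfect_matching G N) #|N :&: edge_cut G X|.

Definition is_cycle C : Prop :=
  exists s : seq T,
    [/\ uniq s, 2 < size s, vset C = [set x in s] &
        eset C = [set [set x; next s x] | x in s]].

Definition contains_pm M G : Prop :=
  exists N : {set {set T}}, N \subset M /\ perfect_matching G N.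

Definition conformal G M K : Prop :=
  [/\ subgraph K G,
      contains_pm M (del_vertices G (vset K)) &
      contains_pm M K].

Definition crosses G X C : Prop := eset C :&: edge_cut G X != set0.

Definition guard G M X F : Prop :=
  [/\ F \subset M,
      edge_cut G X :&: M \subset F &
      forall C, is_cycle C -> conformal G M C -> crosses G X C ->
        F :&: eset C != set0].

End Definitions.

(* Main.v *)
Require Import Defs.
From mathcomp Require Import all_boot.
From mathcomp Require Import zify.

Set Implicit Arguments.
Unset Strict Implicit.
Unset Printing Implicit Defensive.

(** Weighting the edges of [B] by membership in the cut, the porosity is the
    maximum weight of a perfect matching.  By Egervary's duality theorem there
    are integral vertex potentials dominating the weight on every edge whose
    sum over all vertices is [k]; here they are written as differences [Y - Z]
    of natural numbers.  Take for [F] the edges of [M] of positive potential: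
    there are at most [k] of them, and all edges of [M] in the cut are among
    them.  A conformal cycle avoiding [F] is covered by edges of [M] of
    potential zero, so its edges, each vertex being counted twice, have total
    potential zero, and none of them can have positive weight. *)

(** * Hall's marriage theorem *)

Section Hall.
Variables (T U : finType).
Implicit Types (A S : {set T}) (N : T -> {set U}).

(** Induction on a bound for [#|A|], split on whether some nonempty proper subset of [A] meets
    Hall's condition with equality. The point [u0] is only the value of [f] when [A] is empty. *)
Lemma Hall_marriage (u0 : U) A N :
  (forall S, S \subset A -> #|S| <= #|\bigcup_(a in S) N a|) ->
  exists f : T -> U, {in A &, injective f} /\ {in A, forall a, f a \in N a}.
Proof.
move: {2}#|A| (leqnn #|A|) => n; elim: n A N => [|n IHn] A N.
  rewrite leqn0 cards_eq0 => /eqP-> _.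
  by exists (fun=> u0); split=> x; rewrite inE.
move=> leAn hallA.
have [A0|[a aA]] := set_0Vmem A.
  by exists (fun=> u0); rewrite A0; split=> x; rewrite inE.
case: (boolP [exists S : {set T},
  [&& S \proper A, S != set0 & #|\bigcup_(a in S) N a| <= #|S|]]).
- case/existsP=> S /and3P[pSA nS0 tightS].
  have sSA := proper_sub pSA.
  have leSn : #|S| <= n by rewrite -ltnS (leq_trans (proper_card pSA)).
  have [S' sS'|f [injf fN]] := IHn S N leSn.
    exact/hallA/(subset_trans sS').
  set W := \bigcup_(a in S) N a in tightS.
  have [||g [injg gN]] := IHn (A :\: S) (fun x => N x :\: W).
  + rewrite -ltnS (leq_trans _ leAn) // -(cardsID S A).
    by rewrite (setIidPr sSA) -[X in X < _]add0n ltn_add2r card_gt0.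
  (* Hall's condition survives on [A :\: S] with [W] removed: apply it to [S :|: S'] and cancel
     [#|W| <= #|S|]. *)
  + move=> S'; rewrite subsetD => /andP[sS'A disS'].
    have := hallA (S :|: S'); rewrite subUset sSA sS'A => /(_ isT).
    rewrite cardsU setIC (disjoint_setI0 disS') cards0 subn0 bigcup_setU -/W.
    have -> : W :|: \bigcup_(i in S') N i = W :|: \bigcup_(i in S') (N i :\: W).
      apply/setP=> u; rewrite !inE; case: (boolP (u \in W)) => //= nWu.
      by apply/bigcupP/bigcupP=> -[i iS' uN]; exists i => //;
        move: uN; rewrite inE nWu.
    move/leq_trans/(_ (leq_card_setU _ _)) => h.
    by rewrite -(leq_add2l #|S|) (leq_trans h) // leq_add2r.
  have fW x : x \in S -> f x \in W by move=> xS; apply/bigcupP; exists x; auto.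
  have gW x : x \in A -> x \notin S -> g x \in N x :\: W.
    by move=> xA nxS; apply: gN; rewrite inE nxS.
  exists (fun x => if x \in S then f x else g x); split.
    move=> x x' xA x'A; case: ifPn => xS; case: ifPn => x'S.
    + exact: injf.
    + by move=> fg; have := gW _ x'A x'S; rewrite -fg inE fW.
    + by move=> gf; have := gW _ xA xS; rewrite gf inE fW.
    + by apply: injg; rewrite inE ?xS ?x'S.
  move=> x xA; case: ifPn => xS; first exact: fN.
  by have := gW _ xA xS; rewrite inE => /andP[].
(* Every nonempty proper subset now has a surplus neighbour, so [a] may take any neighbour [u]:
   deleting [u] costs each remaining set at most one. *)
- rewrite negb_exists => /forallP strict.
  have [u uNa] : exists u, u \in N a.
    apply/card_gt0P.
    by have := hallA [set a]; rewrite sub1set aA big_set1 cards1 => /(_ isT).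
  have [||f [injf fN]] := IHn (A :\ a) (fun x => N x :\ u).
  + by move: leAn; rewrite (cardsD1 a) aA.
  + move=> S sSA; have [->|nS0] := eqVneq S set0; first by rewrite cards0.
    have pSA : S \proper A by apply: (sub_proper_trans sSA); rewrite properD1.
    have := strict S; rewrite pSA nS0 /= -ltnNge => ltS.
    have -> : \bigcup_(i in S) (N i :\ u) = (\bigcup_(i in S) N i) :\ u.
      apply/setP=> v; rewrite !inE; apply/bigcupP/andP.
        by case=> i iS; rewrite !inE => /andP[-> vN]; split=> //; apply/bigcupP; exists i.
      by case=> nvu /bigcupP[i iS vN]; exists i; rewrite // !inE nvu.
    rewrite -ltnS (leq_trans ltS) // (cardsD1 u (\bigcup_(i in S) N i)).
    by rewrite -[X in _ <= X]add1n leq_add2r leq_b1.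
  have fNu x : x \in A -> x != a -> f x \in N x :\ u.
    by move=> xA nxa; apply: fN; rewrite !inE nxa.
  exists (fun x => if x == a then u else f x); split.
    move=> x x' xA x'A; case: eqVneq => [->|xa]; case: eqVneq => [->|x'a] //.
    + by move=> uf; have := fNu _ x'A x'a; rewrite -uf !inE eqxx.
    + by move=> fu; have := fNu _ xA xa; rewrite fu !inE eqxx.
    + by apply: injf; rewrite !inE ?xa ?x'a.
  move=> x xA; case: eqVneq => [->//|xa].
  by have := fNu _ xA xa; rewrite inE => /andP[].
Qed.

End Hall.

(** * Egerváry's duality for perfect matchings *)

Section Duality.
Variables (T : finType) (B : sgraph T).
Implicit Types (Y Z : T -> nat) (w : {set T} -> nat) (M N : {set {set T}}).

Lemma perfect_matching_sum Y N :
  perfect_matching B N ->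
  \sum_(e in N) \sum_(v in e) Y v = \sum_(v in vset B) Y v.
Proof. by case/and3P=> _ triv /eqP<-; rewrite big_trivIset. Qed.

Definition dual_feasible w Y Z :=
  {in eset B, forall e : {set T}, w e + \sum_(v in e) Z v <= \sum_(v in e) Y v}.

(** Sum the edge inequalities over [M], which covers each vertex once. This keeps the truncated
    difference [gap] below faithful. *)
Lemma dual_feasible_sum_le w Y Z M :
  perfect_matching B M -> dual_feasible w Y Z ->
  \sum_(v in vset B) Z v <= \sum_(v in vset B) Y v.
Proof.
move=> pmM feas; rewrite -!(perfect_matching_sum _ pmM).
have /and3P[/subsetP sM _ _] := pmM.
by apply: leq_sum => e /sM/feas; apply: leq_trans; apply: leq_addl.
Qed.

Section Bipartition.
Variables A1 A2 : {set T}.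
Hypotheses (A12 : A1 :|: A2 = vset B) (disA : [disjoint A1 & A2]).
Hypothesis edgeA :
  {in eset B, forall e : {set T}, #|e :&: A1| = 1 /\ #|e :&: A2| = 1}.

Lemma edge_endpoints e :
  e \in eset B -> exists a b, [/\ a \in A1, b \in A2, a != b & e = [set a; b]].
Proof.
move=> eB; have [/eqP/cards1P[a ea] /eqP/cards1P[b eb]] := edgeA eB.
have [se _] := esetP eB.
have /setIP[ae aA] : a \in e :&: A1 by rewrite ea set11.
have /setIP[be bA] : b \in e :&: A2 by rewrite eb set11.
exists a, b; split=> //.
  by apply: contraTneq bA => <-; rewrite (disjointFr disA).
by rewrite -(setIidPl se) -A12 setIUr ea eb.
Qed.

Lemma perfect_matching_card_sides M : perfect_matching B M -> #|A1| = #|A2|.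
Proof.
case/and3P=> /subsetP sM trivM /eqP cM.
have cardA (A : {set T}) : A \subset vset B ->
    {in eset B, forall e : {set T}, #|e :&: A| = 1} -> #|A| = #|M|.
  move=> sA eA; rewrite -(setIidPr sA) -cM -sum1_card.
  under eq_bigl do rewrite inE.
  rewrite big_trivIset_cond // -sum1_card; apply: eq_bigr => e /sM/eA eA1.
  by rewrite -[RHS]eA1 -sum1_card; apply: eq_bigl => x; rewrite inE.
by rewrite !cardA // -?A12 ?subsetUl ?subsetUr // => e /edgeA[].
Qed.

Lemma injection_perfect_matching (f : T -> T) :
  #|A1| = #|A2| -> {in A1 &, injective f} ->
  {in A1, forall a, f a \in A2} -> {in A1, forall a, [set a; f a] \in eset B} ->
  perfect_matching B [set [set a; f a] | a in A1].
Proof.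
move=> cardA injf fA2 fB.
have fA1 a : a \in A1 -> (f a \in A1) = false.
  by move=> /fA2; apply: (disjointFl disA).
apply/and3P; split.
- by apply/subsetP=> _ /imsetP[a aA ->]; apply: fB.
- apply/trivIsetP=> _ _ /imsetP[a aA ->] /imsetP[b bA ->] neq.
  have {}neq : a != b by apply: contraNneq neq => ->.
  have nf : f a != f b by apply: contraNneq neq => /injf->.
  have afb : a != f b by apply: contraTneq aA => ->; rewrite fA1.
  have bfa : f a != b by apply: contraTneq bA => <-; rewrite fA1.
  rewrite -setI_eq0; apply/eqP/setP=> x; rewrite !inE.
  by apply/negP=> /andP[/orP[]/eqP->];
    rewrite ?(negPf neq) ?(negPf nf) ?(negPf afb) ?(negPf bfa).
- rewrite -A12; apply/eqP/setP=> x; apply/bigcupP/setUP.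
    by case=> _ /imsetP[a aA ->] /set2P[]->; [left | right; apply: fA2].
  have imf : f @: A1 = A2.
    apply/eqP; rewrite eqEcard card_in_imset // cardA leqnn andbT.
    by apply/subsetP=> _ /imsetP[a aA ->]; apply: fA2.
  case=> [xA|]; first by exists [set x; f x]; [apply: imset_f | apply: set21].
  rewrite -imf => /imsetP[a aA ->].
  by exists [set a; f a]; [apply: imset_f | apply: set22].
Qed.

(* One step of the Hungarian method.  Lowering [Y] on a set [S] violating
   Hall's condition and [Z] on its tight neighbourhood is implemented, up to a
   shift by the constant 1, as raising them on the complements. *)
Lemma dual_step w Y Z M :
  perfect_matching B M -> dual_feasible w Y Z ->
  (exists N, perfect_matching B N /\
     {in N, forall e : {set T},
        w e + \sum_(v in e) Z v = \sum_(v in e) Y v}) \/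
  exists Y' Z', dual_feasible w Y' Z' /\
    \sum_(v in vset B) Y' v + \sum_(v in vset B) Z v <
    \sum_(v in vset B) Y v + \sum_(v in vset B) Z' v.
Proof.
move=> pmM feas; have cardA := perfect_matching_card_sides pmM.
pose tight e := (e \in eset B) && (w e + \sum_(v in e) Z v == \sum_(v in e) Y v).
pose nb a := [set b in A2 | tight [set a; b]].
case: (boolP [forall S : {set T},
  (S \subset A1) ==> (#|S| <= #|\bigcup_(a in S) nb a|)]).
- move/forallP=> hall; left.
  have [A10|[u0 _]] := set_0Vmem A1.
    exists set0; split; last by move=> e; rewrite inE.
    have A20 : A2 = set0 by apply/eqP; rewrite -cards_eq0 -cardA A10 cards0.
    rewrite /perfect_matching sub0set -A12 A10 A20 setU0 /cover big_set0 eqxx.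
    by rewrite andbT; apply/trivIsetP=> x; rewrite inE.
  have [S sS|f [injf fnb]] := @Hall_marriage _ _ u0 A1 nb.
    by have := hall S; rewrite sS.
  exists [set [set a; f a] | a in A1]; split.
    apply: injection_perfect_matching => // a /fnb; rewrite inE => /andP[] //.
    by move=> _ /andP[].
  move=> _ /imsetP[a /fnb aA ->].
  by move: aA; rewrite inE => /and3P[_ _ /eqP].
- rewrite negb_forall => /existsP[S]; rewrite negb_imply -ltnNge.
  case/andP=> sSA ltS; right.
  set W := \bigcup_(a in S) nb a in ltS.
  have sWA : W \subset A2.
    by apply/bigcupsP=> a _; apply/subsetP=> b; rewrite inE => /andP[].
  exists (fun v => Y v + (v \in A1 :\: S)), (fun v => Z v + (v \in A2 :\: W)).
  split.
    move=> e eB; have := feas _ eB.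
    have [a [b [aA bA nab eab]]] := edge_endpoints eB.
    rewrite eab !big_setU1 ?inE //= !big_set1 !inE aA bA.
    rewrite (disjointFr disA aA) (disjointFl disA bA) !andbF !andbT !addn0.
    (* If [a] is outside [S], the rise of [Y] pays for any rise of [Z]; if [b] is in [W], [Z] does
       not rise. In the remaining case the edge is not tight, and its integral slack is at least
       1. *)
    have [aS|naS] /= := boolP (a \in S); last by lia.
    have [bW|nbW] /= := boolP (b \in W); first by lia.
    have : ~~ tight [set a; b].
      apply: contraNN nbW => tab; apply/bigcupP; exists a => //.
      by rewrite inE bA.
    rewrite /tight -eab eB eab big_setU1 ?inE //= big_set1.
    by rewrite big_setU1 ?inE //= big_set1; lia.
  have sumI (A : {set T}) : A \subset vset B ->
      \sum_(v in vset B) (v \in A : nat) = #|A|.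
    move=> sA; rewrite -big_mkcondr -sum1_card; apply: eq_bigl => v.
    by apply/andb_idl/(subsetP sA).
  have sA1 : A1 :\: S \subset vset B by rewrite -A12 subDset setUCA subsetUl.
  have sA2 : A2 :\: W \subset vset B by rewrite -A12 subDset setUA subsetUr.
  (* The totals of [Y] and [Z] grow by [#|A1| - #|S|] and [#|A2| - #|W|]; the sides have equal size
     and [#|W| < #|S|]. *)
  rewrite !big_split /= !sumI //.
  have := cardsID S A1; have := cardsID W A2.
  by rewrite (setIidPr sSA) (setIidPr sWA); lia.
Qed.

End Bipartition.

(** Each failure to find a tight perfect matching lowers the total potential [gap], which cannot
    become negative, so [dual_step] eventually yields one. *)
Lemma Egervary_duality w M :
  bipartite B -> perfect_matching B M ->
  exists Y Z N, [/\ dual_feasible w Y Z, perfect_matching B N &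
    {in N, forall e : {set T}, w e + \sum_(v in e) Z v = \sum_(v in e) Y v}].
Proof.
move=> [A1 [A2 [A12 disA edgeA]]] pmM.
pose gap Y Z := \sum_(v in vset B) Y v - \sum_(v in vset B) Z v.
suff descent n Y Z : gap Y Z <= n -> dual_feasible w Y Z ->
    exists Y Z N, [/\ dual_feasible w Y Z, perfect_matching B N &
    {in N, forall e : {set T}, w e + \sum_(v in e) Z v = \sum_(v in e) Y v}].
  (* A constant potential equal to the total weight dominates every single weight. *)
  apply: (descent _ (fun=> \sum_e w e) (fun=> 0) (leqnn _)) => e eB.
  rewrite big1 // addn0 sum_nat_const (esetP eB).2 (bigD1 e) //=; lia.
elim: n Y Z => [|n IHn] Y Z le_n feas;
  have [[N [pmN tN]]|[Y' [Z' [feas' lt']]]] := dual_step A12 disA edgeA pmM feas;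
  try by exists Y, Z, N.
all: have le := dual_feasible_sum_le pmM feas.
all: have le' := dual_feasible_sum_le pmM feas'.
all: rewrite /gap in le_n.
  (* At gap 0 a further step would make the total of [Y'] smaller than that of [Z']. *)
  by lia.
by apply: (IHn Y' Z') => //; rewrite /gap; lia.
Qed.

End Duality.

(** * The guard obtained from the potentials *)

Lemma big_next (T : finType) (s : seq T) (Y : T -> nat) :
  uniq s -> \sum_(x in s) Y (next s x) = \sum_(x in s) Y x.
Proof.
move=> us; rewrite [RHS](reindex_inj (can_inj (prev_next us))) /=.
by apply: eq_bigl => x; rewrite mem_next.
Qed.

Theorem theorem2p2 (T : finType) (B : sgraph T) (M : {set {set T}})
    (X : {set T}) (k : nat) :
  bipartite B ->
  perfect_matching B M ->
  X \subset vset B ->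
  matching_porosity B X = k ->
  exists F : {set {set T}}, guard B M X F /\ #|F| <= 2 * k + k ^ 2.
Proof.
move=> bipB pmM _ <-.
have [Y [Z [N [feas pmN tightN]]]] :=
  Egervary_duality (fun e => e \in edge_cut B X) bipB pmM.
have /and3P[/subsetP sM _ _] := pmM.
pose F := [set e in M | \sum_(v in e) Z v < \sum_(v in e) Y v].
exists F; split; last first.
  suff : #|F| <= matching_porosity B X by lia.
  apply: (@leq_trans #|N :&: edge_cut B X|); last first.
    exact: (@leq_bigmax_cond _ _ (fun N => #|N :&: edge_cut B X|)).
  (* Vertex sums can be read along [M] or along [N]. Along [N], tightness turns cut edges plus [Z]
     into [Y]; along [M], each edge of [F] has potential at least 1 and the others at least 0. *)
  rewrite -(leq_add2r (\sum_(v in vset B) Z v)).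
  rewrite -{1}(perfect_matching_sum Z pmM) -(perfect_matching_sum Z pmN).
  have cardI (P Q : {set {set T}}) : #|P :&: Q| = \sum_(e in P) (e \in Q).
    by rewrite -sum1_card -big_mkcondr; apply: eq_bigl => e; rewrite inE.
  have /setIidPr<- : F \subset M by apply/subsetP=> e; rewrite inE => /andP[].
  rewrite !cardI -!big_split /= (eq_bigr _ tightN).
  rewrite (perfect_matching_sum Y pmN) -(perfect_matching_sum Y pmM).
  apply: leq_sum => e eM; rewrite inE eM /=.
  by have := feas _ (sM _ eM); case: ltnP => //=; lia.
split.
- by apply/subsetP=> e; rewrite inE => /andP[].
- apply/subsetP=> e /setIP[eX eM]; rewrite inE eM /=.
  by have := feas _ (sM _ eM); rewrite eX; lia.
move=> C [s [us _ vC eC]] [[_ /subsetP sCB] _ [N' [/subsetP sN'M pmN']]].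
case/set0Pn=> e /setIP[eC' eX]; apply/negP=> /eqP FC.
(* The edges of [N'] lie in [M] and in [C], hence avoid [F], and they cover each vertex of [C]
   once. *)
have sumC : \sum_(v in vset C) Y v <= \sum_(v in vset C) Z v.
  rewrite -!(perfect_matching_sum _ pmN'); apply: leq_sum => f fN'.
  have /and3P[/subsetP/(_ _ fN') fC _ _] := pmN'.
  have /setP/(_ f) := FC; rewrite !inE fC sN'M //= andbT => /negbT.
  by rewrite -leqNgt.
have sumV (W : T -> nat) : \sum_(v in vset C) W v = \sum_(x in s) W x.
  by apply: eq_bigl => x; rewrite vC inE.
have edgeC x : x \in s -> [set x; next s x] \in eset B.
  by move=> xs; apply: sCB; rewrite eC; apply: imset_f.
have sum2 (W : T -> nat) x : x \in s ->
    \sum_(v in [set x; next s x]) W v = W x + W (next s x).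
  move=> /edgeC/esetP[_]; rewrite cards2 => card2.
  by rewrite big_setU1 ?big_set1 // inE; case: eqP card2.
have [x xs ex] : exists2 x, x \in s & e = [set x; next s x].
  by move: eC'; rewrite eC => /imsetP.
have : \sum_(x in s) ([set x; next s x] \in edge_cut B X)
       + (\sum_(x in s) Z x + \sum_(x in s) Z (next s x))
       <= \sum_(x in s) Y x + \sum_(x in s) Y (next s x).
  rewrite -!big_split /=; apply: leq_sum => z zs.
  by have := feas _ (edgeC _ zs); rewrite !sum2.
(* The crossing edge [e] contributes weight 1, so twice the total of [Y] on [C] exceeds twice that
   of [Z], against [sumC]. *)
rewrite (bigD1 x) //= -ex eX !(big_next _ us) -!sumV /=; lia.
Qed.
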